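(* For every integer $n\ge 3$, \[ \overline{\mathrm{lcr}}(K_n) \ge \begin{cases} \frac{1}{9}(n-3)^2 & \text{if } n \equiv 0 \pmod 3,\\ \frac{1}{9}(n-1)(n-4) & \text{if } n \equiv 1 \pmod 3,\\ \frac{1}{9}(n-2)^2-\left\lfloor \frac{n-2}{6} \right\rfloor & \text{if } n \equiv 2 \pmod 3.\end{cases} \]
   Context: A rectilinear drawing of the complete graph $K_n$ consists of $n$ points in the plane in general position (no three collinear), the vertices, with every pair of vertices joined by the straight line segment between them, the edges. Two edges cross if their segments intersect at a point that is not a common endpoint. The local crossing number of a drawing is the largest number of edges crossing any single edge of the drawing. The rectilinear local crossing number $\overline{\mathrm{lcr}}(K_n)$ is the minimum of the local crossing number over all rectilinear drawings of $K_n$. *)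

(* Defs.v *)
From mathcomp Require Import all_boot all_order all_algebra.
From mathcomp Require Import boolp reals.
From mathcomp Require Import ring.

Set Implicit Arguments.
Unset Strict Implicit.
Unset Printing Implicit Defensive.

Import Order.TTheory GRing.Theory Num.Theory.
Local Open Scope ring_scope.

Definition on_line (R : realType) (a v x : 'rV[R]_2) : Prop :=
  exists t : R, x = a + t *: v.

Definition collinear (R : realType) (x y z : 'rV[R]_2) : Prop :=
  exists a v : 'rV[R]_2,
    v != 0 /\ [/\ on_line a v x, on_line a v y & on_line a v z].

(* Injectivity follows from the second conjunct when n >= 3; it is required
   separately so that the vertices are also distinct when n < 3. *)
Definition general_position (R : realType) (n : nat)
    (p : 'I_n -> 'rV[R]_2) : Prop :=
  injective p /\
  (forall i j k : 'I_n, i != j -> i != k -> j != k ->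
    ~ collinear (p i) (p j) (p k)).

Definition edges (n : nat) : {set {set 'I_n}} :=
  [set e : {set 'I_n} | #|e| == 2%N].

Definition in_segment (R : realType) (a b x : 'rV[R]_2) : Prop :=
  exists t : R, 0 <= t <= 1 /\ x = (1 - t) *: a + t *: b.

Definition on_edge (R : realType) (n : nat) (p : 'I_n -> 'rV[R]_2)
    (e : {set 'I_n}) (x : 'rV[R]_2) : Prop :=
  exists i j : 'I_n, e = [set i; j] /\ in_segment (p i) (p j) x.

Definition crosses (R : realType) (n : nat) (p : 'I_n -> 'rV[R]_2)
    (e f : {set 'I_n}) : Prop :=
  e != f /\
  (exists x : 'rV[R]_2, [/\ on_edge p e x, on_edge p f x &
     ~ exists i : 'I_n, i \in e :&: f /\ x = p i]).

Definition crossings_of (R : realType) (n : nat) (p : 'I_n -> 'rV[R]_2)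
    (e : {set 'I_n}) : nat :=
  #|[set f : {set 'I_n} in edges n | `[< crosses p e f >]]|.

Definition local_crossing (R : realType) (n : nat)
    (p : 'I_n -> 'rV[R]_2) : nat :=
  (\max_(e in edges n) crossings_of p e)%N.

Definition attained_lcr (R : realType) (n m : nat) : Prop :=
  exists p : 'I_n -> 'rV[R]_2, general_position p /\ local_crossing p = m.

Definition parabola (R : realType) (n : nat) (i : 'I_n) : 'rV[R]_2 :=
  \row_(j < 2) (i%:R ^+ j.+1).

Lemma parabola_gp (R : realType) (n : nat) :
  general_position (@parabola R n).
Proof.
have E (i : 'I_n) j : parabola R i 0 j = i%:R ^+ j.+1 by rewrite mxE.
have nat_neq (i j : 'I_n) : i != j -> (i%:R - j%:R : R) != 0.
  by rewrite subr_eq0 eqr_nat.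
split=> [i j /rowP /(_ 0) | i j k ij ik jk].
  by rewrite !E !expr1 => /eqP; rewrite eqr_nat => /eqP /val_inj.
move=> [a [v [_ [[s Hi] [t Hj] [u Hk]]]]].
pose i1 : 'I_2 := lift ord0 ord0.
have coord (w : 'I_n) r : parabola R w = a + r *: v ->
    w%:R = a 0 0 + r * v 0 0 /\ w%:R ^+ 2 = a 0 i1 + r * v 0 i1.
  move=> /rowP H; move: (H 0) (H i1).
  by rewrite !E !mxE expr1.
have [xi yi] := coord _ _ Hi; have [xj yj] := coord _ _ Hj.
have [xk yk] := coord _ _ Hk.
have det0 : (j%:R - i%:R) * (k%:R ^+ 2 - i%:R ^+ 2)
          - (k%:R - i%:R) * (j%:R ^+ 2 - i%:R ^+ 2) = 0 :> R.
  by rewrite yi yj yk xi xj xk; ring.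
have : (i%:R - j%:R) * (i%:R - k%:R) * (j%:R - k%:R) != 0 :> R.
  by rewrite !mulf_neq0 ?nat_neq.
move/eqP; apply; rewrite -[RHS]oppr0 -det0; ring.
Qed.

Lemma attained_lcr_ex (R : realType) (n : nat) :
  exists m : nat, `[< attained_lcr R n m >].
Proof.
exists (local_crossing (@parabola R n)); apply/asboolP.
by exists (@parabola R n); split=> //; exact: parabola_gp.
Qed.

(* [ex_minn] is the least element of a nonempty set of naturals, so this is the
   minimum of [local_crossing] over all rectilinear drawings of K_n. *)
Definition rectilinear_lcr (R : realType) (n : nat) : nat :=
  ex_minn (attained_lcr_ex R n).

(* Main.v *)
Require Import Defs.
From mathcomp Require Import all_boot all_order all_algebra.
From mathcomp Require Import boolp reals.
From mathcomp Require Import zify ring lra.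

(* Let A, B be vertices of the convex hull and q another point. The path A q B
   cuts the hull into two parts, so if it separates the other n - 3 points into s
   and n - 3 - s, then at least s (n - 3 - s) edges cross [q A] or [q B], and one
   of these two is crossed by at least half of them. Hence it suffices to find such
   a path with at least k = ceil((n - 3) / 3) points on each side.
   Unless some chord between hull vertices already has enough crossings, there are
   hull vertices A, B, C with fewer than k / 2 points beyond each side of the
   triangle. A point q inside it splits the other points into three sectors. If no
   path through any q is balanced, then either for some q all the sectors have
   k - 1 points, and counting the crossings of [q A], [q B] and [q C] together gives
   the bound, or every q has a sector with more than n - 3 - k points; a minimal
   such sector leads to a contradiction.
   Apart from the existence of enough hull vertices, the argument uses only the
   orientations of triples of points. *)

Set Implicit Arguments.
Unset Strict Implicit.
Unset Printing Implicit Defensive.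

Import Order.TTheory GRing.Theory Num.Theory.

(** * Orientations of triples *)

(** Each pair of [setX S W] is counted in [P] as it stands or in [Q] reversed. [P] and [Q] will be
    the crossings at the two edges of a path. *)
Lemma card_pairs_cover (T : finType) (P Q : {set T * T}) (S W : {set T}) :
  (forall u v, u \in S -> v \in W -> ((u, v) \in P) || ((v, u) \in Q)) ->
  #|S| * #|W| <= #|P :&: setX S W| + #|Q :&: setX W S|.
Proof.
move=> cover; pose swap (e : T * T) := (e.2, e.1).
have swapI : injective swap by move=> [a b] [c d] [-> ->].
rewrite -cardsX -(card_imset (mem (Q :&: setX W S)) swapI).
apply: leq_trans (leq_card_setU _ _); apply: subset_leq_card.
apply/subsetP => -[u v]; rewrite !inE /= => /andP[Su Wv].
rewrite Su Wv andbT; case/orP: (cover u v Su Wv) => [-> //|Qvu].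
by apply/orP; right; apply/imsetP; exists (v, u); rewrite // !inE /= Qvu Su Wv.
Qed.

(** The last element of [S] in the order [r] is preceded by the rest of [S] and by all of [E], but
    by fewer than [k] elements altogether. *)
Lemma card_chain_bound (T : finType) (r : rel T) (S E : {set T}) (k : nat) :
  transitive r -> irreflexive r ->
  {in S &, forall u v, u != v -> r u v || r v u} ->
  {in S, forall v, #|[set u | r u v]| < k} ->
  {in S, forall v, E \subset [set u | r u v]} ->
  [disjoint E & S] -> S != set0 -> #|S| + #|E| <= k.
Proof.
move=> r_tr r_irr r_tot r_lt r_sub dES /set0Pn[v0 Sv0].
pose rank v := #|[set u | r u v]|.
case: (@arg_maxnP _ v0 (mem S) rank Sv0) => v Sv vmax.
have below u : u \in S -> u != v -> r u v.
  move=> Su uv; case/orP: (r_tot u v Su Sv uv) => // rvu.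
  have := vmax u Su; rewrite /= leqNgt => /negP; case.
  apply: proper_card; apply/properP; split; last first.
    by exists v; rewrite inE // r_irr.
  by apply/subsetP => w; rewrite !inE => /r_tr; apply.
have sub : (S :\ v) :|: E \subset [set u | r u v].
  rewrite subUset r_sub // andbT; apply/subsetP => u; rewrite !inE.
  by case/andP=> uv Su; apply: below.
have d : (S :\ v) :&: E = set0.
  apply/setP => u; rewrite !inE; apply/negP => /andP[/andP[_ Su] Eu].
  by rewrite (disjointFr dES Eu) in Su.
have := leq_ltn_trans (subset_leq_card sub) (r_lt v Sv).
have -> : #|S| = #|S :\ v|.+1 by rewrite (cardsD1 v S) (Sv : v \in S).
rewrite cardsU d cards0 subn0; lia.
Qed.

Section Chirotope.

Variables (T : finType) (o : T -> T -> T -> bool).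
Hypothesis o_cyc : forall i j k, o i j k = o j k i.
Hypothesis o_irr : forall i j, o i i j = false.
Hypothesis o_swap : forall i j k,
  i != j -> i != k -> j != k -> o i k j = ~~ o i j k.
(** With q inside the triangle a b c, no open half-plane bounded by a line through q contains all of
    a, b, c. *)
Hypothesis o_cone : forall q a b c u, o q a b -> o q b c -> o q c a ->
  o q u a -> o q u b -> o q u c -> False.
Hypothesis o_coneV : forall q a b c u, o q a b -> o q b c -> o q c a ->
  o q a u -> o q b u -> o q c u -> False.

(* P lies in no triangle; in this form it also says that the order of the other
   points by angle around P is transitive. *)
Definition hull_vertex P :=
  forall u v w, o P u v -> o P v w -> o P w u -> False.

Definition left_of A B := [set x | o A B x].

Definition sector q A B := [set u | o q A u && o q u B].

(* When P is a hull vertex these are exactly the segments that cross [q P],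
   directed from right to left. *)
Definition crossing_pairs q P :=
  [set e : T * T | [&& o q e.1 P, o q P e.2 & o q e.1 e.2]].

Definition in_triangle A B C q := [&& o A B q, o B C q & o C A q].

Lemma o_irr2 i j : o i j j = false. Proof. by rewrite o_cyc. Qed.
Lemma o_irr3 i j : o i j i = false. Proof. by rewrite o_cyc o_irr2. Qed.

Lemma o_neq i j k : o i j k -> [/\ i != j, i != k & j != k].
Proof.
move=> h; split; apply/eqP => e; move: h; rewrite e.
- by rewrite o_irr.
- by rewrite o_irr3.
- by rewrite o_irr2.
Qed.

Lemma o_anti i j k : o i j k -> o i k j = false.
Proof. by move=> h; case: (o_neq h) => *; rewrite o_swap ?h. Qed.

Lemma hull_vertex_trans A u v w :
  hull_vertex A -> o A u v -> o A v w -> o A u w.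
Proof.
move=> hA h1 h2; have [Au _ _] := o_neq h1; have [_ Aw _] := o_neq h2.
have uw : u != w by apply/eqP => e; move: h2; rewrite -e (o_anti h1).
by rewrite o_swap // 1?eq_sym //; apply/negP => h3; apply: (hA _ _ _ h1 h2 h3).
Qed.

Lemma card_left_right A B :
  A != B -> #|left_of A B| + #|left_of B A| + 2 = #|T|.
Proof.
move=> AB; rewrite -(cardsC (left_of A B)) -addnA; congr (_ + _).
have -> : ~: left_of A B = left_of B A :|: [set A; B].
  apply/setP => x; rewrite !inE.
  case: (eqVneq x A) => [->|xA]; first by rewrite o_irr3 orbT.
  case: (eqVneq x B) => [->|xB]; first by rewrite o_irr2 !orbT.
  by rewrite /= orbF [RHS]o_cyc [RHS]o_swap // eq_sym.
rewrite cardsU cards2 AB (_ : _ :&: _ = set0) ?cards0 ?subn0 //.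
apply/setP => x; rewrite !inE; apply/negP => /andP[h /orP[]] /eqP e;
  by move: h; rewrite e ?o_irr3 ?o_irr2.
Qed.

(* If A and B are hull vertices, the path A q B cuts the convex hull in two, so
   a segment leaving the sector crosses [q A] or [q B]. *)
Lemma sector_pair_crosses q A B u v : o q A B -> u \in sector q A B ->
  v \notin sector q A B -> v \notin [set q; A; B] ->
  ((u, v) \in crossing_pairs q B) || ((v, u) \in crossing_pairs q A).
Proof.
move=> qAB; rewrite !inE /= => /andP[qAu quB] nv.
rewrite !negb_or -andbA => /and3P[vq vA vB].
have [qA qB _] := o_neq qAB; have [_ qu _] := o_neq qAu.
have uv : u != v.
  by apply/eqP => e; move: nv; rewrite -e qAu quB.
have qv : q != v by rewrite eq_sym.
have vAE : o q v A = ~~ o q A v by rewrite o_swap // eq_sym.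
have vBE : o q v B = ~~ o q B v by rewrite o_swap // eq_sym.
have vuE : o q v u = ~~ o q u v by rewrite o_swap.
rewrite quB qAu vAE vuE /=; rewrite vBE in nv.
case quv: (o q u v) => /=; rewrite ?andbT ?andbF ?orbF.
  case qBv: (o q B v) => //; exfalso.
  have qvA : o q v A by rewrite vAE; move: nv; rewrite qBv andbT.
  by apply: (o_coneV qAu quv qvA qAB quB); rewrite vBE qBv.
apply/negP => qAv; rewrite qAv /= negbK in nv.
by apply: (o_cone quB nv _ qAu qAB qAv); rewrite vuE quv.
Qed.

Lemma sector_crossings q A B : o q A B ->
  #|sector q A B| * (#|T| - 3 - #|sector q A B|) <=
  #|crossing_pairs q A| + #|crossing_pairs q B|.
Proof.
move=> qAB; have [qA qB AB] := o_neq qAB.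
set X := sector q A B; pose W := ~: (X :|: [set q; A; B]).
have cW : #|W| = #|T| - 3 - #|X|.
  have := cardsC (X :|: [set q; A; B]); rewrite -/W cardsU.
  have -> : X :&: [set q; A; B] = set0.
    apply/setP => u; rewrite !inE; apply/negP => /andP[/andP[h1 h2]].
    have [_ h3 h4] := o_neq h1; have [_ _ h5] := o_neq h2.
    by rewrite ![u == _]eq_sym (negPf h3) (negPf h4) eq_sym (negPf h5).
  have -> : #|[set q; A; B]| = 3.
    by rewrite setUC cardsU1 cards2 !inE ![B == _]eq_sym (negPf qB) (negPf AB) qA.
  rewrite cards0; lia.
have cover u v : u \in X -> v \in W ->
    ((u, v) \in crossing_pairs q B) || ((v, u) \in crossing_pairs q A).
  move=> Xu; rewrite inE inE negb_or => /andP[Xv nv].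
  exact: sector_pair_crosses.
rewrite -cW addnC; apply: leq_trans (card_pairs_cover cover) _.
by apply: leq_add; apply/subset_leq_card/subsetIl.
Qed.

(** * Points inside a triangle and their three sectors *)

Lemma in_triangle_rot A B C q : in_triangle A B C q = in_triangle B C A q.
Proof. by rewrite /in_triangle andbC -andbA. Qed.

Lemma in_triangle_center A B C q :
  in_triangle A B C q -> [/\ o q A B, o q B C & o q C A].
Proof. by case/and3P; rewrite !(o_cyc q). Qed.

Lemma in_triangle_sub A B C q q' : hull_vertex A -> hull_vertex B ->
  in_triangle A B C q -> in_triangle A B q q' -> in_triangle A B C q'.
Proof.
move=> hA hB /and3P[ABq BCq CAq] /and3P[ABq' Bqq' qAq'].
apply/and3P; split=> //; first exact: (hull_vertex_trans hB BCq Bqq').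
rewrite o_cyc; apply: (@hull_vertex_trans A q' q C hA).
  by rewrite -o_cyc.
by rewrite -o_cyc.
Qed.

Lemma sector_proper A B q q' : hull_vertex A -> hull_vertex B ->
  in_triangle A B q q' -> sector q' A B \proper sector q A B.
Proof.
move=> hA hB /and3P[ABq' Bqq' qAq']; apply/properP; split.
  apply/subsetP => u; rewrite !inE => /andP[h1 h2]; apply/andP; split.
    rewrite o_cyc; apply: (@hull_vertex_trans A u q' q hA).
      by rewrite -o_cyc.
    by rewrite -o_cyc.
  rewrite -o_cyc; apply: (@hull_vertex_trans B q q' u hB) => //.
  by rewrite o_cyc.
exists q'; last by rewrite inE o_irr3.
by rewrite inE qAq' -o_cyc.
Qed.

(** For u other than q, A, B, C, the signs [o q A u], [o q B u], [o q C u] are not all equal. A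
    nonconstant cyclic word of three bits has exactly one descent, which tells the sector of u. *)
Lemma sector_partition A B C q : in_triangle A B C q ->
  #|sector q A B| + #|sector q B C| + #|sector q C A| + 4 = #|T|.
Proof.
case/in_triangle_center => qAB qBC qCA.
have [qA qB AB] := o_neq qAB; have [_ qC BC] := o_neq qBC.
have [_ _ CA] := o_neq qCA.
have qBA := o_anti qAB; have qCB := o_anti qBC; have qAC := o_anti qCA.
have c4 : #|[set q; A] :|: [set B; C]| = 4.
  rewrite cardsU !cards2 qA BC (_ : _ :&: _ = set0) ?cards0 //.
  apply/setP => x; rewrite !inE; apply/negP => /andP[].
  case/orP => /eqP ->; first by rewrite (negPf qB) (negPf qC).
  by rewrite (negPf AB) eq_sym (negPf CA).
have sw u : u \notin [set q; A] :|: [set B; C] ->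
  [/\ o q u A = ~~ o q A u, o q u B = ~~ o q B u & o q u C = ~~ o q C u].
  rewrite !inE !negb_or => /andP[/andP[uq uA] /andP[uB uC]].
  by split; rewrite o_swap // eq_sym.
have spec u P Q : u \in [set q; A] :|: [set B; C] ->
    (P, Q) \in [:: (A, B); (B, C); (C, A)] -> (u \in sector q P Q) = false.
  move=> hu hPQ; move: hu hPQ; rewrite !inE !xpair_eqE.
  by case/orP=> /orP[] /eqP-> /or3P[] /andP[/eqP-> /eqP->];
     rewrite ?o_irr ?o_irr2 ?o_irr3 ?qBA ?qCB ?qAC ?andbF.
have key u : (u \in sector q A B) + (u \in sector q B C) +
    (u \in sector q C A) + (u \in [set q; A] :|: [set B; C]) = 1.
  case hu: (u \in _ :|: _).
    rewrite !(spec u) // !inE ?eqxx ?orbT //.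
  have [h1 h2 h3] := sw u (negbT hu); rewrite !inE h1 h2 h3.
  case ha: (o q A u); case hb: (o q B u); case hc: (o q C u) => //=.
    by case: (o_coneV qAB qBC qCA ha hb hc).
  by case: (o_cone qAB qBC qCA (u := u)); rewrite ?h1 ?h2 ?h3 ?ha ?hb ?hc.
rewrite -c4 -!sum1_card ![\sum_(_ in _) 1]big_mkcond -!big_split /=.
rewrite [RHS](eq_bigl xpredT) //; apply: eq_bigr => u _; rewrite -[RHS](key u).

by congr (_ + _ + _ + _); case: (u \in _).
Qed.

Lemma crossing_pairs_split q A B C (W Z : {set T}) :
  [disjoint sector q A B & W] ->
  #|crossing_pairs q B :&: setX (sector q A B) Z| +
  #|crossing_pairs q B :&: setX W (sector q B C)| <= #|crossing_pairs q B|.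
Proof.
move=> dXW; rewrite -cardsUI.
have -> : (crossing_pairs q B :&: setX (sector q A B) Z) :&:
    (crossing_pairs q B :&: setX W (sector q B C)) = set0.
  apply/setP => -[u v]; rewrite !in_setI !in_setX in_set0.
  apply/negP => /andP[/and3P[_ Xu _] /and3P[_ Wu _]].
  by rewrite (disjointFr dXW Xu) in Wu.
by rewrite cards0 addn0; apply: subset_leq_card; rewrite subUset !subsetIl.
Qed.

Lemma sector_disjoint A B C q : in_triangle A B C q ->
  [disjoint sector q A B & C |: sector q B C].
Proof.
case/in_triangle_center => _ qBC qCA; apply/pred0P => u /=; rewrite !inE.
apply/negP => /andP[/andP[qAu quB]] /orP[/eqP e|/andP[qBu _]].
  by move: qAu; rewrite e (o_anti qCA).
by move: qBu; rewrite (o_anti quB).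
Qed.

(* Each of the three rays of q serves as a border of two sectors; the segments
   counted at it in either role start in different sets, hence are distinct. *)
Lemma triangle_crossings A B C q : in_triangle A B C q ->
  #|sector q A B| * #|sector q B C|.+1 + #|sector q B C| * #|sector q C A|.+1 +
  #|sector q C A| * #|sector q A B|.+1 <=
  #|crossing_pairs q A| + #|crossing_pairs q B| + #|crossing_pairs q C|.
Proof.
(* The successor comes from C', which also lies outside the sector over A' B'. *)
have half A' B' C' : in_triangle A' B' C' q ->
    #|sector q A' B'| * #|sector q B' C'|.+1 <=
    #|crossing_pairs q B' :&: setX (sector q A' B') (C' |: sector q B' C')| +
    #|crossing_pairs q A' :&: setX (C' |: sector q B' C') (sector q A' B')|.
  move=> tq; have [qA'B' qB'C' qC'A'] := in_triangle_center tq.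
  have <- : #|C' |: sector q B' C'| = #|sector q B' C'|.+1.
    by rewrite cardsU1 inE o_irr2 andbF.
  apply: card_pairs_cover => u v Xu Yv.
  have [_ qC B'C'] := o_neq qB'C'; have [_ qA C'A'] := o_neq qC'A'.
  apply: sector_pair_crosses => //.
    by rewrite (disjointFl (sector_disjoint tq) Yv).
  move: Yv; rewrite !inE => /orP[/eqP->|/andP[qB'v qvC']].
    by rewrite !negb_or eq_sym qC C'A' eq_sym B'C'.
  have [_ qv B'v] := o_neq qB'v.
  rewrite !negb_or eq_sym qv [v == B']eq_sym B'v andbT /=.
  by apply/eqP => e; move: qvC'; rewrite e (o_anti qC'A').
have split' A' B' C' : in_triangle A' B' C' q ->
    #|crossing_pairs q B' :&: setX (sector q A' B') (C' |: sector q B' C')| +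
    #|crossing_pairs q B' :&: setX (A' |: sector q C' A') (sector q B' C')|
    <= #|crossing_pairs q B'|.
  move=> tq; apply: crossing_pairs_split.
  have [qA'B' qB'C' qC'A'] := in_triangle_center tq.
  apply/pred0P => u /=; rewrite !inE.
  apply/negP => /andP[/andP[qA'u quB']] /orP[/eqP e|/andP[qC'u quA']].
    by move: qA'u; rewrite e o_irr2.
  by move: quA'; rewrite (o_anti qA'u).
move=> tA.
have tB : in_triangle B C A q by rewrite -in_triangle_rot.
have tC : in_triangle C A B q by rewrite -in_triangle_rot.
have := half _ _ _ tA; have := half _ _ _ tB; have := half _ _ _ tC.
have := split' _ _ _ tA; have := split' _ _ _ tB; have := split' _ _ _ tC.
lia.
Qed.

(** * Chords from a hull vertex *)

Lemma left_of_proper A B C : hull_vertex A -> o A B C ->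
  left_of A C \proper left_of A B.
Proof.
move=> hA ABC; apply/properP; split; last by exists C; rewrite inE ?o_irr2.
apply/subsetP => u; rewrite !inE; exact: hull_vertex_trans.
Qed.

Lemma left_of_properV A B C : hull_vertex B -> o A B C ->
  left_of C B \proper left_of A B.
Proof.
move=> hB ABC; apply/properP; split; last by exists C; rewrite inE ?o_irr3.
apply/subsetP => u; rewrite !inE o_cyc => BuC; rewrite o_cyc.
by apply: (hull_vertex_trans hB BuC); rewrite -o_cyc.
Qed.

Lemma chord_crossings A B : hull_vertex A ->
  #|left_of B A| * #|left_of A B| <= #|crossing_pairs A B|.
Proof.
move=> hA; rewrite -cardsX; apply: subset_leq_card.
apply/subsetP => -[u v]; rewrite !inE /= => /andP[BAu ABv].
have AuB : o A u B by rewrite -o_cyc.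
by rewrite AuB ABv (hull_vertex_trans hA AuB ABv).
Qed.

(** * The crossing bound for abstract orientations *)

Section Bound.

(* [N] is the number of points off a two-edge path, and [k] is [N / 3] rounded
   up: the size that the smaller side of a balanced path must reach. *)
Variables (m k N : nat).
Hypothesis crossing_le : forall q P, hull_vertex P -> #|crossing_pairs q P| <= m.
Hypothesis card_T : #|T| = N.+3.
Hypothesis k_ge : N <= 3 * k.
Hypothesis k_le : 3 * k <= N.+2.

Lemma balanced_center A B C q :
  hull_vertex A -> hull_vertex B -> hull_vertex C -> in_triangle A B C q ->
  k * (N - k) <= 2 * m \/
  [|| N < #|sector q A B| + k, N < #|sector q B C| + k |
      N < #|sector q C A| + k].
Proof.
move=> hA hB hC tq; have [qAB qBC qCA] := in_triangle_center tq.
have := sector_crossings qAB; have := sector_crossings qBC.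
have := sector_crossings qCA; have := triangle_crossings tq.
have := sector_partition tq.
have := crossing_le q hA; have := crossing_le q hB; have := crossing_le q hC.
rewrite card_T.
move: #|crossing_pairs q A| #|crossing_pairs q B| #|crossing_pairs q C|.
move: #|sector q A B| #|sector q B C| #|sector q C A| => x y z a b c.
rewrite !subnS subn0 /= => cm bm am part tri cz cy cx.
case: (ltnP N (x + k)) => [|xN]; first by right.
case: (ltnP N (y + k)) => [|yN]; first by right.
case: (ltnP N (z + k)) => [|zN]; first by right.
left.
(* The difference of the two products is (w - k)(N - k - w). *)
have mid w : k <= w -> w + k <= N -> k * (N - k) <= w * (N - w).
  move=> kw wN; have [e ->] : exists e, N = w + k + e.
    by exists (N - (w + k)); lia.
  have -> : w + k + e - k = w + e by lia.
  have -> : w + k + e - w = k + e by lia.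
  by rewrite !mulnDr mulnC leq_add2l leq_mul2r kw orbT.
have [/mid/(_ xN) h|xk] := leqP k x; first lia.
have [/mid/(_ yN) h|yk] := leqP k y; first lia.
have [/mid/(_ zN) h|zk] := leqP k z; first lia.
(* All three sizes are below [k], yet they sum to [N - 1], which is at least 3(k - 1) by [k_le]. The
   triangle count [tri] then gives k(k - 1) <= m. *)
have [ex [ey ez]] : x = k.-1 /\ y = k.-1 /\ z = k.-1 by lia.
have eN : N = 3 * k - 2 by lia.
rewrite ex ey ez prednK in tri; last lia.
have -> : N - k = 2 * k.-1 by lia.
rewrite mulnCA (mulnC k); lia.
Qed.

(** The heavy sector and C lie on one side of the line u A, leaving fewer than [k] of the [N.+1]
    other points for the other side. *)
Lemma heavy_sector_rank A C u :
  o u C A -> N < #|sector u C A| + k -> #|[set w | o A w u]| < k.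
Proof.
move=> uCA heavy; have [_ uA _] := o_neq uCA.
have -> : [set w | o A w u] = left_of u A.
  by apply/setP => w; rewrite !inE [RHS]o_cyc.
have : #|C |: sector u C A| <= #|left_of A u|.
  apply: subset_leq_card; apply/subsetP => w; rewrite !inE.
  by case/orP => [/eqP->|/andP[_ uwA]]; rewrite o_cyc.
rewrite cardsU1 inE o_irr2 /=.
have := card_left_right uA; rewrite card_T; lia.
Qed.

Lemma heavy_sector_rankV B C u :
  o u B C -> N < #|sector u B C| + k -> #|[set w | o B u w]| < k.
Proof.
move=> uBC heavy; have [uB _ _] := o_neq uBC.
have : #|C |: sector u B C| <= #|left_of u B|.
  apply: subset_leq_card; apply/subsetP => w; rewrite !inE.
  by case/orP => [/eqP->|/andP[]].
rewrite cardsU1 inE o_irr2 andbF /=.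
have := card_left_right uB; rewrite card_T [left_of B u]/left_of; lia.
Qed.

(* Take a minimal counterexample q. Every point of the triangle A B q has a
   smaller sector over A B, hence a heavy sector over C A or B C; it is then among
   the first [k - 1] points in the angular order around A or around B. The points
   beyond A B come first in both orders, so there are too few such points. *)
Lemma no_heavy_sector A B C q : hull_vertex A -> hull_vertex B ->
  2 * #|left_of B A| < k ->
  (forall q, in_triangle A B C q ->
    [|| N < #|sector q A B| + k, N < #|sector q B C| + k |
        N < #|sector q C A| + k]) ->
  in_triangle A B C q -> #|sector q A B| + k <= N.
Proof.
move=> hA hB small heavy.
have [s] := ubnP #|sector q A B|; elim: s q => // s IHs q qs tq.
rewrite leqNgt; apply/negP => big.
have sub q' : in_triangle A B q q' -> in_triangle A B C q'.
  exact: in_triangle_sub.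
have [qAB _ _] := in_triangle_center tq; have [_ _ AB] := o_neq qAB.
pose D := left_of B A.
pose SA := [set q' | in_triangle A B q q' & N < #|sector q' C A| + k].
pose SB := [set q' | in_triangle A B q q' & N < #|sector q' B C| + k].
(* A point of the sector lies beyond A B or in the triangle A B q. In the latter case its own sector
   over A B is smaller, so by induction the heavy one is another. *)
have cover : sector q A B \subset D :|: (SA :|: SB).
  apply/subsetP => u; rewrite !inE => /andP[qAu quB].
  have [_ _ Au] := o_neq qAu; have [_ _ uB] := o_neq quB.
  case BAu: (o B A u) => //=.
  have tu : in_triangle A B q u.
    rewrite /in_triangle qAu (o_cyc B q) quB o_cyc !andbT.
    by rewrite (@o_swap B A u) ?BAu // eq_sym.
  have lt := leq_trans (proper_card (sector_proper hA hB tu)) qs.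
  have := heavy u (sub u tu); rewrite ltnNge (IHs u lt (sub u tu)) tu /=.
  by rewrite orbC.
have boundA : SA != set0 -> #|SA| + #|B |: D| <= k.
  apply: (@card_chain_bound _ (o A)).
  - by move=> v u w; apply: hull_vertex_trans.
  - exact: o_irr2.
  - move=> u v; rewrite !inE => /andP[/and3P[/o_neq[_ Au _] _ _] _].
    move=> /andP[/and3P[/o_neq[_ Av _] _ _] _] uv.
    by rewrite (@o_swap A u v) // orbN.
  - move=> u; rewrite inE => /andP[/sub/in_triangle_center[_ _ uCA]].
    exact: heavy_sector_rank.
  - move=> u; rewrite inE => /andP[/and3P[ABu _ _] _].
    rewrite subUset sub1set inE ABu /=; apply/subsetP => w; rewrite !inE => h.
    by apply: (hull_vertex_trans hA _ ABu); rewrite -o_cyc.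
  apply/pred0P => u /=; rewrite !inE; apply/negP.
  move=> /andP[h /andP[/and3P[ABu _ _] _]]; move: h.
  have [_ _ Bu] := o_neq ABu.
  by rewrite eq_sym (negPf Bu) /= o_cyc (o_anti ABu).
(* Around B the angular order is read backwards, so that A and the points beyond A B again come
   first. *)
have boundB : SB != set0 -> #|SB| + #|A |: D| <= k.
  apply: (@card_chain_bound _ (fun w v => o B v w)).
  - by move=> v u w /= h1 h2; apply: (hull_vertex_trans hB h2).
  - by move=> u /=; apply: o_irr2.
  - move=> u v; rewrite !inE => /andP[/and3P[/o_neq[_ _ Bu] _ _] _].
    move=> /andP[/and3P[/o_neq[_ _ Bv] _ _] _] uv.
    by rewrite (@o_swap B u v) // orNb.
  - move=> u; rewrite inE => /andP[/sub/in_triangle_center[_ uBC _]].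
    exact: heavy_sector_rankV.
  - move=> u; rewrite inE => /andP[/and3P[ABu _ _] _].
    have BuA : o B u A by rewrite -o_cyc.
    rewrite subUset sub1set inE BuA /=; apply/subsetP => w; rewrite !inE.
    exact: hull_vertex_trans.
  apply/pred0P => u /=; rewrite !inE; apply/negP.
  move=> /andP[h /andP[/and3P[ABu _ _] _]]; move: h.
  have [_ Au _] := o_neq ABu.
  by rewrite eq_sym (negPf Au) /= o_cyc (o_anti ABu).
(* If [SA] and [SB] are both nonempty, the sector has at most 2k - 2 - |D| points, against [big] and
   [k_le]. If both are empty it lies in [D], which is too small. *)
have := subset_leq_card cover.
have := (leq_card_setU D (SA :|: SB)).1; have := (leq_card_setU SA SB).1.
move: boundA boundB; rewrite !cardsU1 !inE o_irr3 o_irr2 /= -/D.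
case: (eqVneq SA set0) => [->|_]; case: (eqVneq SB set0) => [->|_];
  rewrite ?cards0 => bA bB; try have := bA isT; try have := bB isT;
  move: small big; rewrite -/D; lia.
Qed.

Hypothesis farthest : forall A B, hull_vertex A -> hull_vertex B -> A != B ->
  left_of A B != set0 -> exists2 C, hull_vertex C & o A B C.

(* A chord A B with at least [k / 2] points on either side has enough crossings;
   otherwise move to the farthest point on the big side. *)
Lemma small_triangle A B : hull_vertex A -> hull_vertex B -> A != B ->
  k <= 2 * #|left_of A B| ->
  k * (N - k) <= 2 * m \/
  exists A' B' C', [/\ hull_vertex A', hull_vertex B', hull_vertex C',
    o A' B' C' & [/\ 2 * #|left_of B' A'| < k, 2 * #|left_of C' B'| < k &
                   2 * #|left_of A' C'| < k]].
Proof.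
have [s] := ubnP #|left_of A B|; elim: s A B => // s IHs A B ABs hA hB AB big.
have lr : #|left_of A B| + #|left_of B A| = N.+1.
  by have := card_left_right AB; rewrite card_T; lia.
have [bigR|smallR] := leqP k (2 * #|left_of B A|).
  left; have := chord_crossings B hA; have := crossing_le A hB.
  move: lr bigR big; set l := #|left_of A B|; set r := #|left_of B A|.
  move: #|crossing_pairs A B| => c lr bigR big cm rc.
  (* Both sides are doubled since k / 2 need not be an integer. With 2l = k + i and 2r = k + j, the
     product is at least k(i + j). *)
  suff : k * (2 * (N - k)) <= (2 * r) * (2 * l).
    by rewrite mulnCA mulnACA; lia.
  have [i ei] : exists i, 2 * l = k + i by exists (2 * l - k); lia.
  have [j ej] : exists j, 2 * r = k + j by exists (2 * r - k); lia.
  have le_ij : 2 * (N - k) <= i + j by lia.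
  apply: leq_trans (leq_mul (leqnn k) le_ij) _.
  rewrite ei ej !mulnDr !mulnDl [k * j]mulnC; lia.
have [C hC ABC] : exists2 C, hull_vertex C & o A B C.
  by apply: farthest => //; apply/eqP => e; move: big; rewrite e cards0; lia.
have [_ AC BC] := o_neq ABC.
have [bigA|smallA] := leqP k (2 * #|left_of A C|).
  apply: (IHs A C) => //.
  exact: leq_trans (proper_card (left_of_proper hA ABC)) _.
have [bigB|smallB] := leqP k (2 * #|left_of C B|).
  apply: (IHs C B) => //; last by rewrite eq_sym.
  exact: leq_trans (proper_card (left_of_properV hB ABC)) _.
by right; exists A, B, C.
Qed.

(** The regions beyond the three sides hold at most 3(k - 1) / 2 points in all, fewer than [N], so
    some point besides A, B, C is in none of them. *)
Lemma exists_in_triangle A B C : o A B C ->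
  2 * #|left_of B A| < k -> 2 * #|left_of C B| < k ->
  2 * #|left_of A C| < k -> exists q, in_triangle A B C q.
Proof.
move=> ABC sA sB sC; have [AB AC BC] := o_neq ABC.
pose U := (left_of B A :|: left_of C B) :|: (left_of A C :|: [set A; B; C]).
have c3 : #|[set A; B; C]| <= 3.
  by rewrite setUC cardsU1 cards2; case: (_ \notin _); case: (_ != _).
have cU : #|U| < #|T|.
  rewrite card_T /U.
  have := (leq_card_setU (left_of B A :|: left_of C B)
    (left_of A C :|: [set A; B; C])).1.
  have := (leq_card_setU (left_of B A) (left_of C B)).1.
  have := (leq_card_setU (left_of A C) [set A; B; C]).1; lia.
have /set0Pn[q] : ~: U != set0 by rewrite -card_gt0; have := cardsC U; lia.
rewrite !inE !negb_or -!andbA.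
move=> /and5P[nBA nCB nAC qA /andP[qB qC]]; exists q.
by apply/and3P; split; rewrite o_cyc o_swap // eq_sym.
Qed.

(** If the bound fails, every point of a small triangle has a heavy sector, while [no_heavy_sector],
    applied to the three rotations of the triangle, excludes each sector in turn. *)
Lemma crossing_bound A B : hull_vertex A -> hull_vertex B -> A != B ->
  k * (N - k) <= 2 * m.
Proof.
move=> hA hB AB; rewrite leqNgt; apply/negP => lt.
have notle : ~ k * (N - k) <= 2 * m by rewrite leqNgt lt.
have BA : B != A by rewrite eq_sym.
have not_small A' B' C' : hull_vertex A' -> hull_vertex B' ->
    hull_vertex C' -> o A' B' C' -> 2 * #|left_of B' A'| < k ->
    2 * #|left_of C' B'| < k -> 2 * #|left_of A' C'| < k -> False.
  move=> hA' hB' hC' ABC sA sB sC.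
  have [q tq] := exists_in_triangle ABC sA sB sC.
  have heavy p : in_triangle A' B' C' p ->
    [|| N < #|sector p A' B'| + k, N < #|sector p B' C'| + k |
        N < #|sector p C' A'| + k].
    by case/(balanced_center hA' hB' hC').
  have tB : in_triangle B' C' A' q by rewrite -in_triangle_rot.
  have tC : in_triangle C' A' B' q by rewrite -in_triangle_rot.
  have := heavy q tq; rewrite !ltnNge (no_heavy_sector hA' hB' sA heavy tq).
  rewrite (no_heavy_sector hB' hC' sB _ tB); last first.
    by move=> p; rewrite -in_triangle_rot => /heavy; rewrite orbC -orbA.
  rewrite (no_heavy_sector hC' hA' sC _ tC) // => p.
  by rewrite in_triangle_rot => /heavy; rewrite orbA orbC.
have : k <= 2 * #|left_of A B| \/ k <= 2 * #|left_of B A|.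
  have := card_left_right AB; rewrite card_T; lia.
case=> [/(small_triangle hA hB AB)|/(small_triangle hB hA BA)] [//|];
by case=> A' [B' [C' [hA' hB' hC' ABC [sA sB sC]]]];
   apply: (not_small A' B' C').
Qed.

End Bound.

End Chirotope.

(** * Drawings in the plane *)

Local Open Scope ring_scope.

(** Twice the signed area of the triangle a b c, positive when it runs counterclockwise. *)
Definition area2 (R : realType) (a b c : 'rV[R]_2) : R :=
  (b 0 0 - a 0 0) * (c 0 1 - a 0 1) - (c 0 0 - a 0 0) * (b 0 1 - a 0 1).

Lemma rV2_eq (R : realType) (a b : 'rV[R]_2) :
  a 0 0 = b 0 0 -> a 0 1 = b 0 1 -> a = b.
Proof.
move=> e0 e1; apply/rowP => i.
by case: (unliftP 0 i) => [j ->|-> //]; rewrite (_ : lift 0 j = 1) //;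
   apply/val_inj; rewrite /= (ord1 j).
Qed.

Lemma area2_eq0_collinear (R : realType) (a b c : 'rV[R]_2) :
  a != b -> area2 a b c = 0 -> collinear a b c.
Proof.
move=> ab abc0; have v0 : b - a != 0 by rewrite subr_eq0 eq_sym.
exists a, (b - a); split=> //; split.
- by exists 0; rewrite scale0r addr0.
- by exists 1; rewrite scale1r addrC subrK.
rewrite /area2 in abc0.
(* The parameter of c on the line is read off a coordinate in which a and b differ. *)
have [x0|x0] := eqVneq (b 0 0 - a 0 0) 0; last first.
  exists ((c 0 0 - a 0 0) / (b 0 0 - a 0 0)); apply: rV2_eq; rewrite !mxE.
    by field.
  apply: (mulfI x0); apply/eqP; rewrite -subr_eq0; apply/eqP.
  by rewrite -abc0; field.
have y0 : b 0 1 - a 0 1 != 0.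
  apply: contra v0 => /eqP y0; apply/eqP; apply: rV2_eq; rewrite !mxE //.
exists ((c 0 1 - a 0 1) / (b 0 1 - a 0 1)); apply: rV2_eq; rewrite !mxE.
  move: abc0; rewrite x0 mul0r sub0r mulr0 addr0 => /eqP.
  by rewrite oppr_eq0 mulf_eq0 (negPf y0) orbF subr_eq0 => /eqP.
by field.
Qed.

Section Drawing.

Variables (R : realType) (n : nat) (p : 'I_n -> 'rV[R]_2).
Hypothesis gp : general_position p.

Let area i j k := area2 (p i) (p j) (p k).

Definition orient i j k := 0 < area2 (p i) (p j) (p k).

Lemma area_cyc i j k : area i j k = area j k i.
Proof. by rewrite /area /area2; ring. Qed.

Lemma area_swap i j k : area i k j = - area i j k.
Proof. by rewrite /area /area2; ring. Qed.

Lemma orient_cyc i j k : orient i j k = orient j k i.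
Proof. by rewrite /orient -!/(area _ _ _) area_cyc. Qed.

Lemma orient_irr i j : orient i i j = false.
Proof. by rewrite /orient /area2 !subrr mul0r mulr0 subrr ltxx. Qed.

Lemma orient_swap i j k :
  i != j -> i != k -> j != k -> orient i k j = ~~ orient i j k.
Proof.
move=> ij ik jk; have [inj ncol] := gp.
have pij : p i != p j by apply: contra ij => /eqP /inj ->.
have nz : area i j k != 0.
  by apply/eqP => /(area2_eq0_collinear pij); apply: ncol.
rewrite /orient -!/(area _ _ _) area_swap oppr_gt0 -leNgt le_eqVlt.
by rewrite (negPf nz).
Qed.

(** The linear relation between the plane vectors a - q, b - q, c - q, paired with u - q. *)
Lemma area_cone q a b c u :
  area q b c * area q u a + area q c a * area q u b + area q a b * area q u c
  = 0.
Proof. by rewrite /area /area2; ring. Qed.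

Lemma orient_cone q a b c u :
  orient q a b -> orient q b c -> orient q c a ->
  orient q u a -> orient q u b -> orient q u c -> False.
Proof.
rewrite /orient -!/(area _ _ _) => ab bc ca ua ub uc.
have := area_cone q a b c u; apply/eqP; rewrite gt_eqF //.
by rewrite !addr_gt0 // mulr_gt0.
Qed.

Lemma orient_coneV q a b c u :
  orient q a b -> orient q b c -> orient q c a ->
  orient q a u -> orient q b u -> orient q c u -> False.
Proof.
rewrite /orient -!/(area _ _ _) => ab bc ca au bu cu.
have := area_cone q a b c u; apply/eqP; rewrite lt_eqF //.
rewrite !(area_swap q _ u) !mulrN -!opprD oppr_lt0.
by rewrite !addr_gt0 // mulr_gt0.
Qed.

Lemma crossing_pair_crosses q P u v : hull_vertex orient P ->
  (u, v) \in crossing_pairs orient q P -> crosses p [set q; P] [set u; v].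
Proof.
move=> hP; rewrite inE /= => /and3P[quP qPv quv].
have neq := o_neq orient_cyc orient_irr.
have [qu qP uP] := neq _ _ _ quP; have [_ qv Pv] := neq _ _ _ qPv.
(* Otherwise P would lie in the triangle q u v. Hence q and P are on opposite sides of the line u
   v. *)
have uvP : area u v P < 0.
  have Pv' : orient P v q by rewrite -orient_cyc.
  have Pq : orient P q u by rewrite orient_cyc.
  have nPuv : ~~ orient P u v by apply/negP; apply: hP Pv' Pq.
  have [_ _ uv] := neq _ _ _ quv.
  have Pu : P != u by rewrite eq_sym.
  have : orient P v u by rewrite (orient_swap Pu Pv uv).
  by rewrite /orient -!/(area _ _ _) area_swap oppr_gt0 area_cyc.
split.
  apply/eqP => /setP/(_ q); rewrite !inE eqxx (negPf qu) (negPf qv).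
  by [].
move: quP qPv quv; rewrite /orient -!/(area _ _ _) => quP qPv quv.
(* [D] is twice the area of the quadrilateral q u P v. Ratios of areas give the positions [t] and
   [s] of the intersection of its diagonals. *)
pose D := area q P v + area q u P.
have D0 : 0 < D by rewrite addr_gt0.
pose t := area q u v / D; pose s := area q u P / D.
have DE : D = area q u v - area u v P by rewrite /D /area /area2; ring.
exists ((1 - t) *: p q + t *: p P); split.
- exists q, P; split=> //; exists t; split=> //.
  apply/andP; split; first by apply: divr_ge0; exact: ltW.
  by rewrite ler_pdivrMr // mul1r DE lerDl oppr_ge0 ltW.
- exists u, v; split=> //; exists s; split.
    apply/andP; split; first by apply: divr_ge0; exact: ltW.
    by rewrite ler_pdivrMr // mul1r lerDr ltW.
  have D1 : D != 0 by rewrite gt_eqF.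
  apply: rV2_eq; rewrite !mxE /t /s; apply: (mulfI D1);
    rewrite !(mulrDr D) !mulrA; apply/eqP; rewrite -subr_eq0; apply/eqP.
  + have -> : D * (1 - area q u v / D) = D - area q u v by field.
    have -> : D * (1 - area q u P / D) = D - area q u P by field.
    have -> : D * area q u v / D = area q u v by field.
    have -> : D * area q u P / D = area q u P by field.
    by rewrite /D /area /area2; ring.
  + have -> : D * (1 - area q u v / D) = D - area q u v by field.
    have -> : D * (1 - area q u P / D) = D - area q u P by field.
    have -> : D * area q u v / D = area q u v by field.
    have -> : D * area q u P / D = area q u P by field.
    by rewrite /D /area /area2; ring.
case=> i [+ _]; rewrite !inE => /andP[/orP[] /eqP->].
  by rewrite (negPf qu) (negPf qv).
by rewrite eq_sym (negPf uP) (negPf Pv).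
Qed.

Lemma crossing_pairs_le q P : hull_vertex orient P ->
  (#|crossing_pairs orient q P| <= local_crossing p)%N.
Proof.
move=> hP; have neq := o_neq orient_cyc orient_irr.
have [->|/set0Pn[[u0 v0]]] := eqVneq (crossing_pairs orient q P) set0.
  by rewrite cards0.
rewrite inE /= => /and3P[/neq[_ qP _] _ _].
have e_edge : [set q; P] \in edges n by rewrite inE cards2 qP.
apply: leq_trans (leq_bigmax_cond _ e_edge).
pose f (e : 'I_n * 'I_n) : {set 'I_n} := [set e.1; e.2].
(* The pairs run from one side of q P to the other, so an edge determines its direction. *)
have f_inj : {in crossing_pairs orient q P &, injective f}.
  move=> [u v] [u' v'] /[!inE] /= /and3P[quP qPv quv] /and3P[quP' qPv' quv'].
  have anti := o_anti orient_cyc orient_irr orient_swap.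
  have [_ _ uv] := neq _ _ _ quv.
  move=> /setP e; have := e u; have := e v; rewrite !inE !eqxx orbT /=.
  have uv' : (u == v') = false.
    by apply/eqP => w; move: quP; rewrite w (anti _ _ _ qPv').
  have vu' : (v == u') = false.
    by apply/eqP => w; move: qPv; rewrite w (anti _ _ _ quP').
  by rewrite uv' vu' orbF => /esym /eqP -> /esym /eqP ->.
rewrite -(card_in_imset f_inj); apply: subset_leq_card.
apply/subsetP => _ /imsetP[[u v] uvF ->]; rewrite inE.
apply/andP; split; last by apply/asboolP; apply: crossing_pair_crosses.
move: uvF; rewrite !inE /= => /and3P[_ _ /neq[_ _ uv]].
by rewrite cards2 uv.
Qed.

(** If P were inside u v w, the nonnegative gaps [f], weighted by positive areas, would sum to zero
    and so vanish. Then u and v would lie on a line through P, against [0 < area P u v]. *)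
Lemma hull_vertex_max (g h : R) (P : 'I_n) : (g != 0) || (h != 0) ->
  (forall j, g * p j 0 0 + h * p j 0 1 <= g * p P 0 0 + h * p P 0 1) ->
  hull_vertex orient P.
Proof.
move=> gh0 maxP u v w; rewrite /orient -!/(area _ _ _) => uv vw wu.
pose f j := g * p P 0 0 + h * p P 0 1 - (g * p j 0 0 + h * p j 0 1).
have f0 j : 0 <= f j by rewrite subr_ge0.
have sum0 : area P v w * f u + area P w u * f v + area P u v * f w = 0.
  by rewrite /f /area /area2; ring.
have nn i j k : 0 < area P i j -> 0 <= area P i j * f k.
  by move=> /ltW ij; apply: mulr_ge0.
move/eqP: sum0; rewrite paddr_eq0 ?addr_ge0 ?nn // paddr_eq0 ?nn //.
rewrite !mulf_eq0 (gt_eqF vw) (gt_eqF wu) /= => /andP[/andP[/eqP fu /eqP fv] _].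
have ag : g * area P u v = (p u 0 1 - p P 0 1) * f v - (p v 0 1 - p P 0 1) * f u.
  by rewrite /f /area /area2; ring.
have ah : h * area P u v = (p v 0 0 - p P 0 0) * f u - (p u 0 0 - p P 0 0) * f v.
  by rewrite /f /area /area2; ring.
move: ag ah; rewrite fu fv !mulr0 subrr => /eqP + /eqP.
rewrite !mulf_eq0 !(gt_eqF uv) !orbF => /eqP g0 /eqP h0.
by move: gh0; rewrite g0 h0 eqxx.
Qed.

Lemma farthest_hull_vertex A B : A != B -> left_of orient A B != set0 ->
  exists2 C, hull_vertex orient C & orient A B C.
Proof.
move=> AB /set0Pn[C0]; rewrite inE => ABC0.
have [C _ maxC] := @arg_maxP _ _ _ C0 xpredT (area A B) isT.
exists C; last exact: lt_le_trans ABC0 (maxC C0 isT).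
(* These are the coefficients of the third point's coordinates in [area A B]. *)
apply: (@hull_vertex_max (p A 0 1 - p B 0 1) (p B 0 0 - p A 0 0)).
  rewrite -negb_and; apply: contra AB => /andP[y0 x0]; have [inj _] := gp.
  apply/eqP/inj/rV2_eq; apply/eqP; last by rewrite -subr_eq0.
  by rewrite eq_sym -subr_eq0.
move=> j; have h : area A B j <= area A B C by exact: maxC.
by rewrite /area /area2 in h; nra.
Qed.

Lemma two_hull_vertices : (3 <= n)%N ->
  exists A B, [/\ hull_vertex orient A, hull_vertex orient B & A != B].
Proof.
move=> n3; pose z := Ordinal (ltnW (ltnW n3)).
have [A _ maxA] := @arg_maxP _ _ _ z xpredT (fun i => p i 0 0) isT.
have [B _ minB] := @arg_minP _ _ _ z xpredT (fun i => p i 0 0) isT.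
have {}maxA j : p j 0 0 <= p A 0 0 by exact: maxA.
have {}minB j : p B 0 0 <= p j 0 0 by exact: minB.
exists A, B; split.
- apply: (@hull_vertex_max 1 0); rewrite ?oner_eq0 // => j.
  by rewrite !mul1r !mul0r !addr0 maxA.
- apply: (@hull_vertex_max (-1) 0); rewrite ?oppr_eq0 ?oner_eq0 // => j.
  by rewrite !mulN1r !mul0r !addr0 lerN2 minB.
(* If the extremes coincide, all points share their first coordinate and every area vanishes. *)
apply/eqP => AB; have xE i : p i 0 0 = p A 0 0.
  by apply/eqP; rewrite eq_le maxA AB minB.
have a0 i j k : area i j k = 0 by rewrite /area /area2 !xE !subrr !mul0r subrr.
pose o1 := Ordinal (ltnW n3); pose o2 := Ordinal n3.
have := @orient_swap z o1 o2 isT isT isT.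
by rewrite /orient -!/(area _ _ _) !a0 ltxx.
Qed.

(** Here [N] is n - 3 and [k] is [n.-1 %/ 3], which is (n - 3) / 3 rounded up. *)
Lemma local_crossing_lower_bound : (3 <= n)%N ->
  (n.-1 %/ 3 * (n - 3 - n.-1 %/ 3) <= 2 * local_crossing p)%N.
Proof.
move=> n3; have [A [B [hA hB AB]]] := two_hull_vertices n3.
apply: (crossing_bound orient_cyc orient_irr orient_swap orient_cone
  orient_coneV crossing_pairs_le _ _ _ _ hA hB AB).
- by rewrite card_ord; lia.
- by lia.
- by lia.
- by move=> A' B' _ _; apply: farthest_hull_vertex.
Qed.

End Drawing.

Theorem theorem3 (R : realType) (n : nat) (hn : (3 <= n)%N) :
  (if (n %% 3 == 0)%N then (n%:R - 3) ^+ 2 / 9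
   else if (n %% 3 == 1)%N then (n%:R - 1) * (n%:R - 4) / 9
   else (n%:R - 2) ^+ 2 / 9 - ((n - 2) %/ 6)%N%:R)
  <= (rectilinear_lcr R n)%:R :> rat.
Proof.
rewrite /rectilinear_lcr; case: ex_minnP => m /asboolP[p [gp <-]] _ {m}.
have := local_crossing_lower_bound gp hn; move: (local_crossing p) => m.
have nE := divn_eq n 3; set j := (n %/ 3)%N in nE.
have : (n %% 3 < 3)%N by rewrite ltn_mod.
case: (n %% 3)%N nE => [|[|[|//]]] nE _ /=.
- have -> : (n.-1 %/ 3 = j.-1)%N by lia.
  have -> : (n - 3 - j.-1 = 2 * j.-1)%N by lia.
  rewrite mulnCA leq_pmul2l // => le_m.
  have -> : (n%:R - 3) ^+ 2 / 9 = (j.-1 * j.-1)%:R :> rat.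
    have -> : n = (3 * j.-1 + 3)%N by lia.
    by rewrite natrD !natrM; field.
  by rewrite ler_nat.
- have -> : (n.-1 %/ 3 = j)%N by lia.
  have -> : (n - 3 - j = 2 * j.-1)%N by lia.
  rewrite mulnCA leq_pmul2l // => le_m.
  have -> : (n%:R - 1) * (n%:R - 4) / 9 = (j * j.-1)%:R :> rat.
    have -> : j = j.-1.+1 by lia.
    have -> : n = (3 * j.-1 + 4)%N by lia.
    by rewrite /= natrD !natrM -natr1; field.
  by rewrite ler_nat.
have -> : (n.-1 %/ 3 = j)%N by lia.
have -> : ((n - 2) %/ 6 = j %/ 2)%N by lia.
have -> : (n - 3 - j = 2 * j - 1)%N by lia.
rewrite mulnBr muln1 mulnCA => le_m.
(* From 2j^2 <= 2m + j, halving and rounding down j / 2 gives the floor term. *)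
have {}le_m : (j * j <= m + j %/ 2)%N.
  by move: (j * j)%N le_m => jj; lia.
have -> : (n%:R - 2) ^+ 2 / 9 = (j * j)%:R :> rat.
  by rewrite nE natrD !natrM; field.
by rewrite lerBlDr -natrD ler_nat.
Qed.
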